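(* Let $n\ge1$ and let $G\subsetneq\mathbb{R}^n$ be a domain. Suppose that $G$ contains some ball $B^n(z_0,r)$ (with $z_0\in\mathbb{R}^n$, $r>0$) and that there are two points $u,v\in\partial G$ such that the segment $[u,v]$ is a diameter of $B^n(z_0,r)$. Then $c=\sqrt5/2$ is the best possible (i.e. smallest) constant for which the inequality $$p_G(x,y)\le c\,\bigl(p_G(x,z)+p_G(z,y)\bigr)$$ is valid for all $x,y,z\in G$.
   Context: A domain is a nonempty open connected set. $B^n(z_0,r)$ is the open Euclidean ball with center $z_0$ and radius $r$, and $[u,v]$ is the Euclidean line segment between $u$ and $v$; that $[u,v]$ is a diameter of $B^n(z_0,r)$ means that $u,v$ are antipodal points of the boundary sphere of the ball. For a domain $G\subsetneq\mathbb{R}^n$ let $d_G(x)=\inf\{|x-z| : z\in\partial G\}$ for $x\in G$. The point pair function is $$p_G(x,y)=\frac{|x-y|}{\sqrt{|x-y|^2+4d_G(x)d_G(y)}},\quad x,y\in G.$$ *)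

(* Defs.v *)
From HB Require Import structures.
From mathcomp Require Import all_boot all_order all_algebra.
From mathcomp Require Import all_classical all_reals all_analysis.
Set Implicit Arguments.
Unset Strict Implicit.
Unset Printing Implicit Defensive.
Import Order.TTheory GRing.Theory Num.Theory.
Import numFieldNormedType.Exports.
Local Open Scope classical_set_scope.
Local Open Scope ring_scope.

(* The library norm on 'rV[R]_n is the sup norm. It induces the same topology
   as the Euclidean norm, so open, closure, interior and connected are the
   library's, but distances, balls and spheres must use enorm, not `|_|. *)
Definition enorm (R : realType) (n : nat) (x : 'rV[R]_n) : R :=
  Num.sqrt (\sum_(i < n) x 0 i ^+ 2).

Definition eball (R : realType) (n : nat) (z0 : 'rV[R]_n) (r : R) :
  set 'rV[R]_n := [set x | enorm (x - z0) < r].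

Definition esphere (R : realType) (n : nat) (z0 : 'rV[R]_n) (r : R) :
  set 'rV[R]_n := [set x | enorm (x - z0) = r].

Definition is_diameter (R : realType) (n : nat) (u v z0 : 'rV[R]_n) (r : R) :
  Prop := [/\ esphere z0 r u, esphere z0 r v & v - z0 = - (u - z0)].

Definition domain (R : realType) (n : nat) (G : set 'rV[R]_n) : Prop :=
  [/\ G !=set0, open G & connected G].

Definition boundary (T : topologicalType) (A : set T) : set T :=
  closure A `\` interior A.

(* The infimum is that of a set bounded below by 0, and nonempty when G is a
   nonempty proper subset of R^n. *)
Definition bdist (R : realType) (n : nat) (G : set 'rV[R]_n) (x : 'rV[R]_n) :
  R := inf [set enorm (x - z) | z in boundary G].

Definition point_pair (R : realType) (n : nat) (G : set 'rV[R]_n)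
  (x y : 'rV[R]_n) : R :=
  enorm (x - y) / Num.sqrt (enorm (x - y) ^+ 2 + 4 * bdist G x * bdist G y).

Definition point_pair_quasi_triangle (R : realType) (n : nat)
  (G : set 'rV[R]_n) (c : R) : Prop :=
  forall x y z : 'rV[R]_n, G x -> G y -> G z ->
    point_pair G x y <= c * (point_pair G x z + point_pair G z y).

(* Main.v *)
(** The distance [f] to the boundary is 1-Lipschitz. Put [a = f x], [b = f y],
    [d = f z], [s = |x - y|], [t = |x - z|], [w = |z - y|],
    [T = sqrt (t^2 + 4ad)], [W = sqrt (w^2 + 4bd)], [p = t / T], [q = w / W].
    From [d <= a + t] we get [T >= 2d - t], and likewise [W >= 2d - w], so
    [2ds <= w(T + t) + t(W + w) = (p + q + 2pq) TW], while
    [16 a b d^2 = (1 - p^2)(1 - q^2) (TW)^2]. Hence [s^2 / (s^2 + 4ab)] is at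
    most [M / (M + (1 - p^2)(1 - q^2))] with [M = (p + q + 2pq)^2], and it
    remains to bound a function of [p] and [q] alone by [5/4 (p + q)^2].
    The constant is attained on the diameter [[u, v]] at [z = z0],
    [x = z0 + (u - z0) / 3] and [y = z0 + (v - z0) / 3]. *)
Require Import Defs.
From HB Require Import structures.
From mathcomp Require Import all_boot all_order all_algebra.
From mathcomp Require Import ring lra.
From mathcomp Require Import all_classical all_reals all_analysis.
Import Order.TTheory GRing.Theory Num.Theory.
Import numFieldNormedType.Exports.
Local Open Scope classical_set_scope.
Local Open Scope ring_scope.


(** * The inequality for real numbers *)

Section Scalar.
Set Implicit Arguments.
Unset Strict Implicit.
Context {R : realType}.
Implicit Types a b d s t w p q : R.

(* Equality holds at [p = q = 1 / 5]. *)
Lemma extremal_polynomial p q : 0 <= p -> 0 <= q ->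
  4 * (p + q + 2 * p * q) ^+ 2 <=
  5 * (p + q) ^+ 2 * ((p + q + 2 * p * q) ^+ 2 + (1 - p ^+ 2) * (1 - q ^+ 2)).
Proof.
move=> p0 q0; rewrite -subr_ge0.
(* The difference is a polynomial in [m = p + q] and [k = p * q], quadratic in [k], to be shown
   nonnegative for [0 <= 4 * k <= m ^+ 2]. *)
have -> : 5 * (p + q) ^+ 2 *
      ((p + q + 2 * p * q) ^+ 2 + (1 - p ^+ 2) * (1 - q ^+ 2)) -
    4 * (p + q + 2 * p * q) ^+ 2 =
  (p + q) ^+ 2 +
    p * q * (p + q) * (10 * (p + q) + 20 * (p + q) ^+ 2 - 16) +
    (p * q) ^+ 2 * (25 * (p + q) ^+ 2 - 16) by ring.
have pq0 : 0 <= p * q by rewrite mulr_ge0.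
have : 4 * (p * q) <= (p + q) ^+ 2.
  have -> : (p + q) ^+ 2 = (p - q) ^+ 2 + 4 * (p * q) by ring.
  by rewrite lerDr sqr_ge0.
have : 0 <= p + q by rewrite addr_ge0.
move: (p + q) (p * q) pq0 => m k k0 m0 km.
(* The sign of the coefficient of [k ^+ 2] decides. If [m >= 4 / 5], the coefficient of [k] is
   nonnegative too. *)
have [large|small] := leP 16 (25 * m ^+ 2).
  have m45 : 4 <= 5 * m by rewrite leNgt; apply/negP => m4; nra.
  rewrite !addr_ge0 ?sqr_ge0 ?mulr_ge0 ?sqr_ge0 ?subr_ge0 //; nra.
have [m_eq0|mN0] := eqVneq m 0.
  rewrite m_eq0 expr0n /= in km *; have -> : k = 0 by lra.
  by rewrite !(expr0n, mul0r, mulr0, addr0).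
have m2 : 0 < m ^+ 2 by rewrite exprn_gt0 // lt0r mN0.
rewrite -(pmulr_rge0 _ m2).
(* Concavity in [k]: compare with the chord between [k = 0] and [k = m ^+ 2 / 4]. *)
have -> : m ^+ 2 * (m ^+ 2 + k * m * (10 * m + 20 * m ^+ 2 - 16) +
      k ^+ 2 * (25 * m ^+ 2 - 16)) =
    (m ^+ 2 - 4 * k) * m ^+ 2 +
    4 * k * m ^+ 2 * (((5 * m - 2) * (m + 2)) / 4) ^+ 2 +
    (m ^+ 2 - 4 * k) * k * (16 - 25 * m ^+ 2) * m ^+ 2 / 4 by field.
have km0 : 0 <= m ^+ 2 - 4 * k by rewrite subr_ge0.
have sm0 : 0 <= 16 - 25 * m ^+ 2 by rewrite subr_ge0 ltW.
(* The square is the value at [k = m ^+ 2 / 4] divided by [m ^+ 2]; it vanishes at [m = 2 / 5], the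
   equality case. *)
have := ltW m2; have := sqr_ge0 ((5 * m - 2) * (m + 2) / 4).
move: (((5 * m - 2) * (m + 2) / 4) ^+ 2) => e e0 M0.
by rewrite !addr_ge0 // ?divr_ge0 // !mulr_ge0.
Qed.

(** [(2 * d - t) ^+ 2 = t ^+ 2 + 4 * d * (d - t)], and [d - t <= a]. *)
Lemma sqrt_add_ge t a d : 0 <= d -> d <= a + t ->
  2 * d <= Num.sqrt (t ^+ 2 + 4 * a * d) + t.
Proof.
move=> d0 dat; rewrite -lerBlDr.
apply: le_trans (ler_norm _) _.
rewrite -sqrtr_sqr ler_wsqrtr //.
nra.
Qed.

Lemma scalar_quasi_triangle a b d s t w :
  0 < a -> 0 < b -> 0 < d -> 0 <= s -> 0 <= t -> 0 <= w ->
  s <= t + w -> d <= a + t -> d <= b + w ->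
  s / Num.sqrt (s ^+ 2 + 4 * a * b) <= Num.sqrt 5 / 2 *
    (t / Num.sqrt (t ^+ 2 + 4 * a * d) + w / Num.sqrt (w ^+ 2 + 4 * d * b)).
Proof.
move=> a0 b0 d0 s0 t0 w0 stw dat dbw.
have -> : 4 * d * b = 4 * b * d by ring.
have T2 : 0 < t ^+ 2 + 4 * a * d by rewrite ltr_wpDl ?sqr_ge0 ?mulr_gt0.
have W2 : 0 < w ^+ 2 + 4 * b * d by rewrite ltr_wpDl ?sqr_ge0 ?mulr_gt0.
have S2 : 0 < s ^+ 2 + 4 * a * b by rewrite ltr_wpDl ?sqr_ge0 ?mulr_gt0.
have := sqrt_add_ge (ltW d0) dat; have := sqrt_add_ge (ltW d0) dbw.
have := sqr_sqrtr (ltW W2); have := sqr_sqrtr (ltW T2).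
have : 0 < Num.sqrt (t ^+ 2 + 4 * a * d) by rewrite sqrtr_gt0.
have : 0 < Num.sqrt (w ^+ 2 + 4 * b * d) by rewrite sqrtr_gt0.
move: (Num.sqrt (t ^+ 2 + _)) (Num.sqrt (w ^+ 2 + _)) => T W W0 T0 eT eW dW dT.
have p0 : 0 <= t / T by rewrite divr_ge0 // ltW.
have q0 : 0 <= w / W by rewrite divr_ge0 // ltW.
have tT : (t / T) * T = t by rewrite divfK // gt_eqF.
have wW : (w / W) * W = w by rewrite divfK // gt_eqF.
move: (t / T) (w / W) p0 q0 tT wW => p q p0 q0 tT wW.
have H := extremal_polynomial p0 q0.
have ds : 2 * d * s <= (p + q + 2 * p * q) * (T * W).
  have -> : (p + q + 2 * p * q) * (T * W) = w * (T + t) + t * (W + w).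
    by rewrite -tT -wW; ring.
  nra.
have abd : 16 * a * b * d ^+ 2 = (1 - p ^+ 2) * (1 - q ^+ 2) * (T * W) ^+ 2.
  have -> : 16 * a * b * d ^+ 2 = (4 * a * d) * (4 * b * d) by ring.
  have -> : 4 * a * d = (1 - p ^+ 2) * T ^+ 2 by rewrite mulrBl -exprMn tT eT; ring.
  have -> : 4 * b * d = (1 - q ^+ 2) * W ^+ 2 by rewrite mulrBl -exprMn wW eW; ring.
  by ring.
have pq0 : 0 <= p + q by rewrite addr_ge0.
rewrite ler_pdivrMr ?sqrtr_gt0 //.
have -> : Num.sqrt 5 / 2 * (p + q) * Num.sqrt (s ^+ 2 + 4 * a * b) =
   (p + q) / 2 * Num.sqrt (5 * (s ^+ 2 + 4 * a * b)).
  by rewrite sqrtrM //; ring.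
have pq20 : 0 <= (p + q) / 2 by rewrite divr_ge0.
rewrite -(ger0_norm pq20) -(sqrtr_sqr ((p + q) / 2)) -sqrtrM ?sqr_ge0 //.
rewrite -{1}(ger0_norm s0) -(sqrtr_sqr s) ler_wsqrtr //.
(* The factor [(2 * d) ^+ 2] brings in the quantities of [ds] and [abd]. *)
suff : 0 <= (2 * d) ^+ 2 *
    (5 * (p + q) ^+ 2 * (s ^+ 2 + 4 * a * b) - 4 * s ^+ 2).
  by rewrite pmulr_rge0 ?exprn_gt0 ?mulr_gt0 //; lra.
have -> : (2 * d) ^+ 2 * (5 * (p + q) ^+ 2 * (s ^+ 2 + 4 * a * b) - 4 * s ^+ 2)
  = (5 * (p + q) ^+ 2 - 4) * (2 * d * s) ^+ 2 +
    5 * (p + q) ^+ 2 * (16 * a * b * d ^+ 2) by ring.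
have abd0 : 0 <= 16 * a * b * d ^+ 2.
  by rewrite !mulr_ge0 ?sqr_ge0 // ltW.
(* The upper bound [ds] helps only when the coefficient of [(2 * d * s) ^+ 2] is negative; the claim
   is then [H] times [(T * W) ^+ 2]. *)
have [le4|lt4] := leP 4 (5 * (p + q) ^+ 2).
  by rewrite addr_ge0 // mulr_ge0 ?subr_ge0 // ?sqr_ge0 // mulr_ge0 ?sqr_ge0.
have ds2 : (2 * d * s) ^+ 2 <= ((p + q + 2 * p * q) * (T * W)) ^+ 2.
  by rewrite lerXn2r ?nnegrE // ?mulr_ge0 ?addr_ge0 ?mulr_ge0 // ltW.
have TW0 : 0 <= (T * W) ^+ 2 by exact: sqr_ge0.
rewrite abd; nra.
Qed.
End Scalar.

(** * The Euclidean norm and its triangle inequality *)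

Section Euclidean.
Set Implicit Arguments.
Unset Strict Implicit.
Context {R : realType} {n : nat}.
Implicit Types x y z : 'rV[R]_n.

Lemma enorm_ge0 x : 0 <= enorm x.
Proof. exact: sqrtr_ge0. Qed.

Lemma sqr_enorm x : enorm x ^+ 2 = \sum_(i < n) x 0 i ^+ 2.
Proof. by rewrite sqr_sqrtr // sumr_ge0 // => i _; rewrite sqr_ge0. Qed.

Lemma enormZ (k : R) x : enorm (k *: x) = `|k| * enorm x.
Proof.
rewrite /enorm -sqrtr_sqr -sqrtrM ?sqr_ge0 // mulr_sumr.
by congr Num.sqrt; apply: eq_bigr => i _; rewrite mxE exprMn.
Qed.

Lemma enormN x : enorm (- x) = enorm x.
Proof. by rewrite -scaleN1r enormZ normrN1 mul1r. Qed.

Lemma enormBC x y : enorm (x - y) = enorm (y - x).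
Proof. by rewrite -enormN opprB. Qed.

Lemma enorm_coord x i : `|x 0 i| <= enorm x.
Proof.
rewrite -sqrtr_sqr ler_wsqrtr // (bigD1 i) //= lerDl.
by rewrite sumr_ge0 // => j _; rewrite sqr_ge0.
Qed.

(** For nonzero norms, the gap times [2 * (enorm x * enorm y)] is a sum of squares. *)
Lemma enorm_cauchy_schwarz x y :
  \sum_(i < n) x 0 i * y 0 i <= enorm x * enorm y.
Proof.
have [x0|x0] := eqVneq (enorm x) 0.
  rewrite x0 mul0r big1 // => i _; have := enorm_coord x i.
  by rewrite x0 normr_le0 => /eqP->; rewrite mul0r.
have [y0|y0] := eqVneq (enorm y) 0.
  rewrite y0 mulr0 big1 // => i _; have := enorm_coord y i.
  by rewrite y0 normr_le0 => /eqP->; rewrite mulr0.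
have xy0 : 0 < 2 * (enorm x * enorm y).
  by rewrite !mulr_gt0 // lt0r ?x0 ?y0 enorm_ge0.
rewrite -subr_ge0 -(pmulr_rge0 _ xy0).
have -> : 2 * (enorm x * enorm y) *
    (enorm x * enorm y - \sum_(i < n) x 0 i * y 0 i) =
    \sum_(i < n) (enorm y * x 0 i - enorm x * y 0 i) ^+ 2.
  transitivity (enorm y ^+ 2 * (\sum_(i < n) x 0 i ^+ 2)
    - 2 * (enorm x * enorm y) * (\sum_(i < n) x 0 i * y 0 i)
    + enorm x ^+ 2 * (\sum_(i < n) y 0 i ^+ 2)).
    by rewrite -!sqr_enorm; ring.
  rewrite !mulr_sumr -sumrB -big_split /=.
  by apply: eq_bigr => i _; ring.
by rewrite sumr_ge0 // => i _; rewrite sqr_ge0.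
Qed.

Lemma ler_enormD x y : enorm (x + y) <= enorm x + enorm y.
Proof.
rewrite -(@ler_pXn2r _ 2) ?nnegrE ?addr_ge0 ?enorm_ge0 //.
rewrite sqrrD !sqr_enorm -mulr_natl.
have -> : \sum_(i < n) (x + y) 0 i ^+ 2 = \sum_(i < n) x 0 i ^+ 2 +
    2 * (\sum_(i < n) x 0 i * y 0 i) + \sum_(i < n) y 0 i ^+ 2.
  rewrite mulr_sumr -!big_split /=.
  by apply: eq_bigr => i _; rewrite mxE; ring.
by rewrite lerD2r lerD2l ler_pM2l // enorm_cauchy_schwarz.
Qed.

Lemma ler_enorm_sub x y z : enorm (x - y) <= enorm (x - z) + enorm (z - y).
Proof. by have := ler_enormD (x - z) (z - y); rewrite subrKA. Qed.

(** [ball] is taken in the sup norm, which the Euclidean norm dominates. *)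
Lemma ball_enorm x y (e : R) : enorm (x - y) < e -> ball x e y.
Proof.
move=> xye; have e0 : 0 < e := le_lt_trans (enorm_ge0 _) xye.
split=> // i j; rewrite (ord1 i) /ball /=.
by apply: le_lt_trans xye; have := enorm_coord (x - y) j; rewrite !mxE.
Qed.
End Euclidean.

(** * The distance to the boundary *)

Section BoundaryDistance.
Set Implicit Arguments.
Unset Strict Implicit.
Context {R : realType} {n : nat} {G : set 'rV[R]_n}.
Implicit Types x y z : 'rV[R]_n.

Lemma bdist_le x z : boundary G z -> bdist G x <= enorm (x - z).
Proof.
move=> Gz; apply: ge_inf; last by exists z.
by exists 0 => _ [y _ <-]; exact: enorm_ge0.
Qed.

Lemma bdist_ge x (m : R) : boundary G !=set0 ->
  (forall z, boundary G z -> m <= enorm (x - z)) -> m <= bdist G x.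
Proof.
move=> [z Gz] mle; apply: lb_le_inf; first by exists (enorm (x - z)), z.
by move=> _ [y Gy <-]; exact: mle.
Qed.

Lemma bdist_lipschitz x y : boundary G !=set0 ->
  bdist G x <= bdist G y + enorm (x - y).
Proof.
move=> G0; rewrite -lerBlDr; apply: bdist_ge => // z Gz.
rewrite lerBlDr addrC; apply: le_trans (bdist_le x Gz) _.
exact: ler_enorm_sub.
Qed.

Lemma boundary_open_notin z : open G -> boundary G z -> ~ G z.
Proof. by move=> Go [_]; have/interior_id -> := Go. Qed.

Lemma bdist_gt0 x : boundary G !=set0 -> open G -> G x -> 0 < bdist G x.
Proof.
move=> G0 Go Gx; have /nbhs_ballP[e /= e0 xeG] := open_nbhs_nbhs (conj Go Gx).
apply: lt_le_trans e0 _; apply: bdist_ge => // z /(boundary_open_notin Go) nGz.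
by rewrite leNgt; apply/negP => /ball_enorm /xeG.
Qed.

(** The nearest boundary point is [u]: every boundary point lies outside the ball, hence at distance
    at least [r - k * r] by the triangle inequality through [z0]. *)
Lemma bdist_radius (z0 u : 'rV[R]_n) (r k : R) : open G ->
  eball z0 r `<=` G -> boundary G u -> esphere z0 r u -> 0 <= k <= 1 ->
  bdist G (z0 + k *: (u - z0)) = (1 - k) * r.
Proof.
rewrite /esphere /= => Go BG Gu ur /andP[k0 k1]; apply/eqP.
rewrite eq_le; apply/andP; split.
  apply: le_trans (bdist_le _ Gu) _.
  have -> : z0 + k *: (u - z0) - u = (k - 1) *: (u - z0).
    by rewrite scalerBl scale1r opprB [z0 + _]addrC -addrA.
  by rewrite enormZ ur ler0_norm ?subr_le0 // opprB.
apply: bdist_ge; first by exists u.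
move=> z /(boundary_open_notin Go) nGz.
have rz : r <= enorm (z - z0).
  by rewrite leNgt; apply/negP => /BG.
have := ler_enorm_sub z z0 (z0 + k *: (u - z0)).
rewrite [z0 + _ - z0]addrAC subrr add0r enormZ ur ger0_norm // [enorm (z - (_ + _))]enormBC.
lra.
Qed.

Lemma open_point_pair_quasi_triangle : boundary G !=set0 -> open G ->
  point_pair_quasi_triangle G (Num.sqrt 5 / 2).
Proof.
move=> G0 Go x y z Gx Gy Gz; apply: scalar_quasi_triangle;
  rewrite ?bdist_gt0 ?enorm_ge0 //.
- exact: ler_enorm_sub.
- by rewrite enormBC; exact: bdist_lipschitz.
- exact: bdist_lipschitz.
Qed.
End BoundaryDistance.

Theorem lemma4p17 (R : realType) (n : nat) (G : set 'rV[R]_n)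
  (z0 : 'rV[R]_n) (r : R) (u v : 'rV[R]_n)
  (hn : (1 <= n)%N)
  (hG : domain G) (hproper : G <> setT)
  (hr : 0 < r) (hball : eball z0 r `<=` G)
  (hu : boundary G u) (hv : boundary G v)
  (huv : is_diameter u v z0 r) :
  point_pair_quasi_triangle G (Num.sqrt 5 / 2) /\
  (forall c : R, point_pair_quasi_triangle G c -> Num.sqrt 5 / 2 <= c).
Proof.
have [_ Go _] := hG; have G0 : boundary G !=set0 by exists u.
split=> [|c qt]; first exact: open_point_pair_quasi_triangle.
have [ur vr vu] := huv.
(* At the fraction [k] of a radius, the point pair function with [z0] is [k / (2 - k)]; [k = 1 / 3]
   gives the extremal value [1 / 5]. *)
have third w : esphere z0 r w -> G (z0 + 3^-1 *: (w - z0)).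
  rewrite /esphere /= => wr; apply: hball; rewrite /eball /=.
  by rewrite addrAC subrr add0r enormZ wr ger0_norm //; lra.
have Gz0 : G z0.
  by apply: hball; rewrite /eball /= subrr -(scale0r u) enormZ normr0 mul0r.
have := qt _ _ _ (third u ur) (third v vr) Gz0.
have k3 : 0 <= (3^-1 : R) <= 1 by apply/andP; split; lra.
have dz0 : bdist G z0 = r.
  have k0 : 0 <= (0 : R) <= 1 by rewrite lexx ler01.
  by have := bdist_radius Go hball hu ur k0; rewrite scale0r addr0 subr0 mul1r.
rewrite /point_pair (bdist_radius Go hball hu ur k3).
rewrite (bdist_radius Go hball hv vr k3).
rewrite dz0 vu scalerN.
have -> : z0 + 3^-1 *: (u - z0) - (z0 - 3^-1 *: (u - z0)) =
    (2 / 3) *: (u - z0).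
  by rewrite opprB [z0 + _]addrC addrACA subrr addr0 -scalerDl; congr (_ *: _); lra.
rewrite [z0 + _ - z0]addrAC subrr add0r subKr !enormZ ur !ger0_norm //.
have -> : (2 / 3 * r) ^+ 2 + 4 * ((1 - 3^-1) * r) * ((1 - 3^-1) * r) =
    5 * (2 / 3 * r) ^+ 2 by field.
have -> : (3^-1 * r) ^+ 2 + 4 * ((1 - 3^-1) * r) * r = (5 / 3 * r) ^+ 2 by field.
have -> : (3^-1 * r) ^+ 2 + 4 * r * ((1 - 3^-1) * r) = (5 / 3 * r) ^+ 2 by field.
have k0 (k : R) : 0 <= k -> Num.sqrt ((k * r) ^+ 2) = k * r.
  by move=> k0; rewrite sqrtr_sqr ger0_norm // mulr_ge0 // ltW.
have r0 : r != 0 by rewrite gt_eqF.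
have s5 : 0 < Num.sqrt 5 :> R by rewrite sqrtr_gt0.
rewrite sqrtrM // !k0; try lra.
have -> : 2 / 3 * r / (Num.sqrt 5 * (2 / 3 * r)) = (Num.sqrt 5)^-1.
  by field; rewrite r0 gt_eqF.
have -> : 3^-1 * r / (5 / 3 * r) = 5^-1 by field.
(* The inequality has become [1 / sqrt 5 <= c * (1 / 5 + 1 / 5)]. *)
rewrite -(ler_pM2l s5) divff ?gt_eqF // => le1.
have : Num.sqrt 5 * Num.sqrt 5 = 5 :> R by rewrite -expr2 sqr_sqrtr.
nra.
Qed.
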